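(* (Maximum principle.) Consider the optimal control problem described in the context. If the problem is solvable, then the optimal controller $u(k-d)$ ($\mathcal{G}_{k-d}$-measurable) satisfies $$0=\mathrm{E}[B_{\theta(k)}'\lambda_k+R_{\theta(k)}u(k-d)\mid\mathcal{G}_{k-d}],\qquad k=d,\dots,N,$$ where the costate $\lambda_k$ satisfies $$\lambda_N=\mathrm{E}[P_{\theta(N+1)}x(N+1)\mid\mathcal{G}_N],$$ $$\lambda_{k-1}=\mathrm{E}[A_{\theta(k)}'\lambda_k+Q_{\theta(k)}x(k)\mid\mathcal{G}_{k-1}],\qquad k=0,\dots,N,$$ and $x$ is the state trajectory generated by the optimal control.
   Context: Let $d>0$ and $N>d$ be integers. $\theta(k)$, $k\ge 0$, is a discrete-time Markov chain with finite state space $\Theta=\{1,\dots,L\}$ and transition probabilities $\mathrm{P}(\theta(k+1)=l_{k+1}\mid\theta(k)=l_k)=\lambda_{l_k,l_{k+1}}$. Let $\mathcal{G}_k$ be the $\sigma$-algebra generated by $\theta(0),\dots,\theta(k)$, and $\mathcal{G}_{-1}$ the trivial $\sigma$-algebra. Consider $$x(k+1)=A_{\theta(k)}(k)x(k)+B_{\theta(k)}(k)u(k-d),\qquad k=0,\dots,N,$$ with $x(k)\in\mathbb{R}^n$, $u(k)\in\mathbb{R}^m$, and deterministic matrices $A_l(k),B_l(k)$ ($l\in\Theta$) of appropriate dimensions. The initial values $x(0)=x_0$ and $u(-d),\dots,u(-1)$ are known, and $\theta$ is independent of them. The cost is $$J_N=\mathrm{E}\Big[\sum_{k=0}^N x(k)'Q_{\theta(k)}(k)x(k)+\sum_{k=d}^N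 u(k-d)'R_{\theta(k)}(k)u(k-d)+x(N+1)'P_{\theta(N+1)}(N+1)x(N+1)\Big],$$ with symmetric $Q_l(k)\ge0$, $R_l(k)\ge0$ (positive semi-definite) and symmetric terminal penalties $P_l(N+1)$ ($l\in\Theta$). The prime denotes transpose. The problem is to find $u=(u(0),\dots,u(N-d))$, with each $u(k)$ being $\mathcal{G}_k$-measurable, minimizing $J_N$; ''solvable'' means such a minimizer exists. Explicit time arguments are suppressed: $A_{\theta(k)}=A_{\theta(k)}(k)$, and similarly for $B,Q,R$ and $P_{\theta(N+1)}=P_{\theta(N+1)}(N+1)$. *)

(* Defs.v *)
From HB Require Import structures.
From mathcomp Require Import all_boot all_order all_algebra.
From mathcomp Require Import all_classical all_reals all_analysis.

Set Implicit Arguments.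
Unset Strict Implicit.
Unset Printing Implicit Defensive.

Import Order.TTheory GRing.Theory Num.Theory.
Import numFieldNormedType.Exports.

Local Open Scope classical_set_scope.
Local Open Scope ring_scope.

Definition qform {R : realType} {n : nat} (M : 'M[R]_n) (v : 'cV[R]_n) : R :=
  (v^T *m M *m v) ord0 ord0.

Definition psdmx {R : realType} {n : nat} (M : 'M[R]_n) : Prop :=
  M \is symmetricmx /\ forall v : 'cV[R]_n, 0 <= qform M v.

(* Only meaningful when P B is nonzero, as for the usual P(A | B). *)
Definition cond_prob {disp} {T : measurableType disp} {R : realType}
    (P : probability T R) (A B : set T) : R :=
  fine (P (A `&` B)) / fine (P B).

(* Finite-state, time-homogeneous Markov chain with transition matrix Lam; the
   state space {1, ..., L} is encoded as 'I_L. The initial law is arbitrary, and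
   conditional probabilities are only constrained where they are defined. *)
Definition markov_chain {disp} {T : measurableType disp} {R : realType}
    (P : probability T R) {L : nat} (Lam : 'M[R]_L) (theta : nat -> T -> 'I_L)
    : Prop :=
  [/\ forall k l, measurable (theta k @^-1` [set l]),
      (forall i j, 0 <= Lam i j) /\ (forall i, \sum_j Lam i j = 1),
      forall (k : nat) (l : nat -> 'I_L),
        let past := [set w | forall j, (j <= k)%N -> theta j w = l j] in
        P past != 0%E ->
        cond_prob P (theta k.+1 @^-1` [set l k.+1]) past =
        cond_prob P (theta k.+1 @^-1` [set l k.+1]) (theta k @^-1` [set l k])
    & forall (k : nat) (i j : 'I_L),
        P (theta k @^-1` [set i]) != 0%E ->
        cond_prob P (theta k.+1 @^-1` [set j]) (theta k @^-1` [set i]) =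
        Lam i j].

(* Generators of the sigma-algebra G_k, for k in Z: the events {theta(j) = l}
   with 0 <= j <= k. For k = -1 there are none, so that G_{-1} is the trivial
   sigma-algebra (see sigma_chain_past_neg). *)
Definition chain_past {T : Type} {L : nat} (theta : nat -> T -> 'I_L) (k : int)
    : set (set T) :=
  [set E | exists (j : nat) (l : 'I_L),
             (j%:Z <= k) /\ E = theta j @^-1` [set l]].

Definition chain_events {T : Type} {L : nat} (theta : nat -> T -> 'I_L)
    : set (set T) :=
  [set E | exists (j : nat) (l : 'I_L), E = theta j @^-1` [set l]].

(* Generators of the sigma-algebra of x0 and ui(-d), ..., ui(-1). *)
Definition init_events {R : realType} {T : Type} {n m : nat} (d : nat)
    (x0 : T -> 'cV[R]_n) (ui : int -> T -> 'cV[R]_m) : set (set T) :=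
  [set E | (exists (i : 'I_n) (Y : set R),
              measurable Y /\ E = (fun w => x0 w i ord0) @^-1` Y) \/
           (exists (j : int) (i : 'I_m) (Y : set R),
              [/\ - d%:Z <= j < 0, measurable Y &
                  E = (fun w => ui j w i ord0) @^-1` Y])].

(* Independence of the sigma-algebras generated by G and H. *)
Definition indep_gen {disp} {T : measurableType disp} {R : realType}
    (P : probability T R) (G H : set (set T)) : Prop :=
  forall E F, <<s G >> E -> <<s H >> F -> P (E `&` F) = (P E * P F)%E.

Definition measurable_wrt {R : realType} {T : pointedType} {p : nat}
    (G : set (set T)) (V : T -> 'cV[R]_p) : Prop :=
  forall i : 'I_p,
    measurable_fun [set: g_sigma_algebraType G]
      ((fun w => V w i ord0) : g_sigma_algebraType G -> R).

(* Y is a version of E[X | <<s G >>]. *)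
Definition is_condexp {disp} {T : measurableType disp} {R : realType}
    (P : probability T R) {p : nat} (G : set (set T)) (X Y : T -> 'cV[R]_p)
    : Prop :=
  [/\ forall i, P.-integrable [set: T] (fun w => (X w i ord0)%:E),
      measurable_wrt G Y,
      forall i, P.-integrable [set: T] (fun w => (Y w i ord0)%:E)
    & forall E, <<s G >> E -> forall i,
        (\int[P]_(w in E) (Y w i ord0)%:E = \int[P]_(w in E) (X w i ord0)%:E)%E].

Fixpoint state {R : realType} {T : Type} {L n m : nat} (d : nat)
    (theta : nat -> T -> 'I_L)
    (A : 'I_L -> nat -> 'M[R]_n) (B : 'I_L -> nat -> 'M[R]_(n, m))
    (x0 : T -> 'cV[R]_n) (u : int -> T -> 'cV[R]_m) (k : nat) (w : T)
    : 'cV[R]_n :=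
  match k with
  | 0%N => x0 w
  | j.+1 => A (theta j w) j *m state d theta A B x0 u j w +
            B (theta j w) j *m u (j%:Z - d%:Z) w
  end.

(* J_N(u); PN l is the terminal penalty P_l(N+1). *)
Definition cost {disp} {T : measurableType disp} {R : realType}
    (P : probability T R) {L n m : nat} (d N : nat) (theta : nat -> T -> 'I_L)
    (A : 'I_L -> nat -> 'M[R]_n) (B : 'I_L -> nat -> 'M[R]_(n, m))
    (Q : 'I_L -> nat -> 'M[R]_n) (Rw : 'I_L -> nat -> 'M[R]_m)
    (PN : 'I_L -> 'M[R]_n)
    (x0 : T -> 'cV[R]_n) (u : int -> T -> 'cV[R]_m) : \bar R :=
  let x := state d theta A B x0 u in
  'E_P[fun w =>
    \sum_(0 <= k < N.+1) qform (Q (theta k w) k) (x k w) +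
    \sum_(d <= k < N.+1) qform (Rw (theta k w) k) (u (k%:Z - d%:Z) w) +
    qform (PN (theta N.+1 w)) (x N.+1 w)].

(* An input sequence is indexed by Z. Its values before time 0 are prescribed
   by ui; its values outside -d, ..., N-d enter neither the state up to time
   N+1 nor the cost. *)
Definition admissible {T : pointedType} {R : realType} {L m : nat} (d N : nat)
    (theta : nat -> T -> 'I_L) (ui u : int -> T -> 'cV[R]_m) : Prop :=
  (forall k : int, - d%:Z <= k < 0 -> u k = ui k) /\
  (forall k : int, 0 <= k <= N%:Z - d%:Z ->
     measurable_wrt (chain_past theta k) (u k)).

Definition optimal {disp} {T : measurableType disp} {R : realType}
    (P : probability T R) {L n m : nat} (d N : nat) (theta : nat -> T -> 'I_L)
    (A : 'I_L -> nat -> 'M[R]_n) (B : 'I_L -> nat -> 'M[R]_(n, m))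
    (Q : 'I_L -> nat -> 'M[R]_n) (Rw : 'I_L -> nat -> 'M[R]_m)
    (PN : 'I_L -> 'M[R]_n)
    (x0 : T -> 'cV[R]_n) (ui u : int -> T -> 'cV[R]_m) : Prop :=
  admissible d N theta ui u /\
  forall v : int -> T -> 'cV[R]_m, admissible d N theta ui v ->
    (cost P d N theta A B Q Rw PN x0 u <= cost P d N theta A B Q Rw PN x0 v)%E.

(* lam : int -> _ is the costate process; only lam(-1), ..., lam(N) matter. *)
Definition costate {disp} {T : measurableType disp} {R : realType}
    (P : probability T R) {L n : nat} (N : nat) (theta : nat -> T -> 'I_L)
    (A Q : 'I_L -> nat -> 'M[R]_n) (PN : 'I_L -> 'M[R]_n)
    (x : nat -> T -> 'cV[R]_n) (lam : int -> T -> 'cV[R]_n) : Prop :=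
  is_condexp P (chain_past theta N%:Z)
    (fun w => PN (theta N.+1 w) *m x N.+1 w) (lam N%:Z) /\
  forall k : nat, (k <= N)%N ->
    is_condexp P (chain_past theta (k%:Z - 1))
      (fun w => (A (theta k w) k)^T *m lam k%:Z w + Q (theta k w) k *m x k w)
      (lam (k%:Z - 1)).

Definition stationary {disp} {T : measurableType disp} {R : realType}
    (P : probability T R) {L n m : nat} (d N : nat) (theta : nat -> T -> 'I_L)
    (B : 'I_L -> nat -> 'M[R]_(n, m)) (Rw : 'I_L -> nat -> 'M[R]_m)
    (u : int -> T -> 'cV[R]_m) (lam : int -> T -> 'cV[R]_n) : Prop :=
  forall k : nat, (d <= k <= N)%N ->
    is_condexp P (chain_past theta (k%:Z - d%:Z))
      (fun w => (B (theta k w) k)^T *m lam k%:Z w +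
                Rw (theta k w) k *m u (k%:Z - d%:Z) w)
      (fun=> 0).

Lemma sigma_chain_past_neg (T : Type) (L : nat) (theta : nat -> T -> 'I_L) :
  <<s chain_past theta (-1) >> = [set set0; [set: T]].
Proof.
apply/seteqP; split=> [E|E [->|->]].
- apply; split; last by move=> F [j [l []]].
  split; first by left.
  + by move=> F [->|->]; rewrite setTD; [right; rewrite setC0|left; rewrite setCT].
  + move=> F hF; have [h|/existsNP[i hi]] := pselect (forall i, F i = set0).
      by left; apply/seteqP; split=> x // [i _]; rewrite h.
    right; apply/seteqP; split=> x // _; exists i => //.
    by case: (hF i) => // ->.
- by move=> S [[]].
- move=> S [[S0 SD _] _]; rewrite -(setD0 setT); exact: SD.
Qed.

(* Deterministic initial data are independent of the chain. *)
Lemma indep_init_cst disp (T : measurableType disp) (R : realType)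
    (P : probability T R) (L n m d : nat) (theta : nat -> T -> 'I_L)
    (a : 'cV[R]_n) (b : int -> 'cV[R]_m) :
  indep_gen P (chain_events theta)
    (init_events d (fun=> a) (fun j : int => fun=> b j)).
Proof.
move=> E F _ hF; suff [->|->] : [set set0; [set: T]] F.
- by rewrite setI0 measure0 mule0.
- by rewrite setIT probability_setT mule1.
have cstP c (Y : set R) : [set set0; [set: T]] ((fun=> c) @^-1` Y).
  have [Yc|Yc] := pselect (Y c).
    by right; apply/seteqP; split.
  by left; apply/seteqP; split.
apply: hF; split.
- rewrite -(sigma_chain_past_neg theta); exact: smallest_sigma_algebra.
- move=> G [[i [Y [_ ->]]]|[j [i [Y [_ _ ->]]]]]; exact: cstP.
Qed.

(* Main.v *)
(* First-order variation. Perturb the optimal input u in the direction 1_E e_i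
   applied at the single time k - d, where E is an event of G_{k-d}. The cost is
   a quadratic polynomial in the size of the perturbation, minimal at 0, so its
   linear coefficient vanishes. Since the response of the state at time j is
   G_{j-1}-measurable, the costate recursion telescopes and turns that
   coefficient into twice the integral over E of the i-th entry of
   B' lambda_k + R u(k-d).
   G_k is generated by a map with finite range, so that G_k-measurable functions
   are bounded and conditional expectations are averages over atoms. *)
Require Import Defs.
From HB Require Import structures.
From mathcomp Require Import all_boot all_order all_algebra.
From mathcomp Require Import all_classical all_reals all_analysis.
From mathcomp Require Import measurable_realfun zify ring lra.

Set Implicit Arguments.
Unset Strict Implicit.
Unset Printing Implicit Defensive.

Import Order.TTheory GRing.Theory Num.Theory.
Import numFieldNormedType.Exports.

Local Open Scope classical_set_scope.
Local Open Scope ring_scope.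

(** * Measurability with respect to the past of the chain, as a condition on finite histories *)

Section ChainAdapted.
Context (disp : measure_display) (T : measurableType disp) (L : nat).
Variable theta : nat -> T -> 'I_L.

(** Only the times 0, ..., k-1 are recorded, so [hist 0] takes a single value and matches the
    trivial $\mathcal{G}_{-1}$; this shift by one keeps all indices natural. *)
Definition hist (k : nat) (w : T) : {ffun 'I_k -> 'I_L} :=
  [ffun j : 'I_k => theta j w].

(* Measurability with respect to G_{k-1}, see measurable_wrtP. *)
Definition adapted (k : nat) (X : Type) (f : T -> X) : Prop :=
  forall w w', hist k w = hist k w' -> f w = f w'.

Lemma adapted_theta k j : (j < k)%N -> adapted k (theta j).
Proof. by move=> jk w w' /ffunP /(_ (Ordinal jk)); rewrite !ffunE. Qed.

Lemma adapted_le k k' X (f : T -> X) :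
  (k <= k')%N -> adapted k f -> adapted k' f.
Proof.
move=> kk' fa w w' h; apply: fa; apply/ffunP => j; rewrite !ffunE.
exact: (adapted_theta (leq_trans (ltn_ord j) kk')).
Qed.

Lemma adapted_comp k X Y (g : X -> Y) (f : T -> X) :
  adapted k f -> adapted k (fun w => g (f w)).
Proof. by move=> fa w w' /fa ->. Qed.

Lemma adapted_comp2 k X Y Z (h : X -> Y -> Z) (f : T -> X) (g : T -> Y) :
  adapted k f -> adapted k g -> adapted k (fun w => h (f w) (g w)).
Proof. by move=> fa ga w w' ww'; rewrite (fa _ _ ww') (ga _ _ ww'). Qed.

(** Doob-Dynkin factorization by choosing a sample point for each history; [x0] is the value on
    sequences that no sample point realizes. As histories form a finite type, [f] has finite
    range. *)
Lemma adapted_factor k X (x0 : X) (f : T -> X) :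
  adapted k f -> exists c, forall w, f w = c (hist k w).
Proof.
move=> fa; exists (fun h => match pselect (exists w, hist k w = h) with
  | left ex => f (projT1 (cid ex)) | right _ => x0 end) => w.
case: pselect => [ex|[]]; last by exists w.
by apply: fa; case: (cid ex).
Qed.

(** The adapted sets form a sigma-algebra containing the generators. Conversely, an adapted set is a
    finite union of fibres of [hist k], and each fibre is a finite intersection of generators. *)
Lemma sigma_chain_pastP k (E : set T) :
  <<s chain_past theta (k%:Z - 1) >> E <-> adapted k E.
Proof.
split=> [|Ea].
  apply; split; first split => //.
  - by move=> F Fa w w' /Fa; rewrite /setD /= => ->.
  - move=> F Fa w w' ww'; rewrite /bigcup /= propeqE.
    by split=> -[i _ Fi]; exists i => //; move: Fi; rewrite (Fa i _ _ ww').
  - move=> F [j [l [jk ->]]] w w' ww' /=.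
    by rewrite (adapted_theta _ ww')//; lia.
have mC (j : 'I_k) l :
    <<s chain_past theta (k%:Z - 1) >> (theta j @^-1` [set l]).
  by apply: sub_sigma_algebra; exists j, l; split => //; have := ltn_ord j; lia.
have mA h : measurable (hist k @^-1` [set h] :
    set (g_sigma_algebraType (chain_past theta (k%:Z - 1)))).
  rewrite (_ : hist k @^-1` [set h] =
    \bigcap_(j in [set: 'I_k]) theta j @^-1` [set h j]); last first.
    apply/seteqP; split => [w /= <- j _ /=|w hw /=]; first by rewrite ffunE.
    by apply/ffunP => j; rewrite ffunE; exact: hw.
  by apply: fin_bigcap_measurable => // j _; exact: mC.
have -> : E = \bigcup_(h in [set h | exists2 w, E w & hist k w = h])
    hist k @^-1` [set h].
  apply/seteqP; split => [w Ew|w [h [w' Ew' <-]] /= /Ea ->//].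
  by exists (hist k w) => //; exists w.
have := @fin_bigcup_measurable _
  (g_sigma_algebraType (chain_past theta (k%:Z - 1))).
by apply => // h _; exact: mA.
Qed.

Lemma measurable_wrtP (R : realType) k p (V : T -> 'cV[R]_p) :
  measurable_wrt (chain_past theta (k%:Z - 1)) V <-> adapted k V.
Proof.
split=> [mV w w' ww'|Va i _ Y mY]; last first.
  rewrite setTI; apply/sigma_chain_pastP => w w' ww' /=.
  by rewrite (Va _ _ ww').
apply/matrixP => i j; rewrite ord1.
(* The preimage of the singleton {V w i} is adapted, so it contains [w'] along with [w]. *)
have := mV i measurableT [set V w i ord0] (measurable_set1 _).
rewrite setTI => /sigma_chain_pastP /(_ _ _ ww') /= e.
by apply/esym; rewrite -e.
Qed.

Hypothesis mtheta : forall k l, measurable (theta k @^-1` [set l]).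

Lemma adapted_measurable_set k (E : set T) : adapted k E -> measurable E.
Proof.
move=> /sigma_chain_pastP; apply; split; first exact: sigma_algebra_measurable.
by move=> F [j [l [_ ->]]].
Qed.

Lemma adapted_measurable_fun k d' (X : measurableType d') (f : T -> X) :
  adapted k f -> measurable_fun setT f.
Proof.
move=> fa _ Y mY; rewrite setTI; apply: (@adapted_measurable_set k).
exact: (adapted_comp (fun x => Y x)).
Qed.

End ChainAdapted.

(** * Integrable and square-integrable real functions *)

Section RealIntegral.
Context (disp : measure_display) (T : measurableType disp) (R : realType).
Variable mu : {measure set T -> \bar R}.
Notation L1 f := (mu.-integrable [set: T] (EFin \o f)).

Lemma L1_ext (f g : T -> R) : f =1 g -> L1 f -> L1 g.
Proof. by move=> /funext ->. Qed.

Lemma L1_measurable (f : T -> R) : L1 f -> measurable_fun [set: T] f.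
Proof. by move=> /integrableP[/measurable_EFinP]. Qed.

Lemma L1D (f g : T -> R) : L1 f -> L1 g -> L1 (fun w => f w + g w).
Proof. by move=> fi gi; have := integrableD measurableT fi gi. Qed.

Lemma L1Z (a : R) (f : T -> R) : L1 f -> L1 (fun w => a * f w).
Proof. by move=> fi; have := integrableZl measurableT a fi. Qed.

Lemma L1_0 : L1 (fun=> 0 : R).
Proof. exact: integrable0. Qed.

Lemma L1_sum (I : eqType) (s : seq I) (F : I -> T -> R) :
  (forall i, i \in s -> L1 (F i)) -> L1 (fun w => \sum_(i <- s) F i w).
Proof.
elim: s => [|i s IH] Fi.
  by apply: L1_ext L1_0 => w; rewrite big_nil.
apply: (@L1_ext (fun w => F i w + \sum_(j <- s) F j w)).
  by move=> w; rewrite big_cons.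
by apply: L1D; [apply: Fi; rewrite mem_head|
  apply: IH => j js; apply: Fi; rewrite inE js orbT].
Qed.

Lemma L1_le (f g : T -> R) : measurable_fun [set: T] f -> L1 g ->
  (forall w, `|f w| <= g w) -> L1 f.
Proof.
move=> mf gi fg; apply: le_integrable gi => //; first exact/measurable_EFinP.
by move=> w _; rewrite lee_fin (le_trans (fg w)) ?ler_norm.
Qed.

Lemma Rintegral_sum (I : eqType) (s : seq I) (F : I -> T -> R) :
  (forall i, i \in s -> L1 (F i)) ->
  \int[mu]_w (\sum_(i <- s) F i w) = \sum_(i <- s) \int[mu]_w F i w.
Proof.
elim: s => [|i s IH] Fi.
  by under eq_Rintegral do rewrite big_nil; rewrite big_nil /Rintegral integral0.
under eq_Rintegral do rewrite big_cons.
have Fs j : j \in s -> L1 (F j) by move=> js; apply: Fi; rewrite inE js orbT.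
by rewrite big_cons RintegralD ?IH//; [apply: Fi; rewrite mem_head|apply: L1_sum].
Qed.

(** Measurability of [f] is a separate clause because it does not follow from that of its square. *)
Definition L2 (f : T -> R) : Prop :=
  measurable_fun [set: T] f /\ L1 (fun w => f w ^+ 2).

Lemma L2_ext (f g : T -> R) : f =1 g -> L2 f -> L2 g.
Proof. by move=> /funext ->. Qed.

Lemma L2_mul (f g : T -> R) : L2 f -> L2 g -> L1 (fun w => f w * g w).
Proof.
move=> [mf fi] [mg gi]; apply: (L1_le (measurable_funM mf mg) (L1D fi gi)) => w.
(* These two squares bound $|fg|$ by $f^2 + g^2$. *)
have := (sqr_ge0 (f w + g w), sqr_ge0 (f w - g w)) => /=.
by case=> *; rewrite ler_norml; apply/andP; split; nra.
Qed.

Lemma L2D (f g : T -> R) : L2 f -> L2 g -> L2 (fun w => f w + g w).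
Proof.
move=> fi gi; split; first by case: fi; case: gi => *; exact: measurable_funD.
apply: (@L1_ext (fun w => f w ^+ 2 + (2 * (f w * g w) + g w ^+ 2))).
  by move=> w; ring.
apply: L1D; first by case: fi.
by apply: L1D; [apply: L1Z; exact: L2_mul|case: gi].
Qed.

Lemma L2_0 : L2 (fun=> 0 : R).
Proof. by split=> //; apply: L1_ext L1_0 => w; rewrite expr0n. Qed.

Lemma L2_sum (I : Type) (s : seq I) (F : I -> T -> R) :
  (forall i, L2 (F i)) -> L2 (fun w => \sum_(i <- s) F i w).
Proof.
move=> Fi; elim: s => [|i s IH].
  by apply: L2_ext L2_0 => w; rewrite big_nil.
by apply: L2_ext (L2D (Fi i) IH) => w; rewrite big_cons.
Qed.

Lemma Lfun_L2 (f : T -> R) : f \in Lfun mu 2%:E -> L2 f.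
Proof.
move=> fL; split; last exact: Lfun2_integrable_sqr.
by move: fL; rewrite inE => /andP[/[!inE]].
Qed.

End RealIntegral.

(** * Integrals against adapted functions, and conditional expectation by averaging over atoms *)

Section AdaptedIntegral.
Context (disp : measure_display) (T : measurableType disp) (R : realType).
Variables (P : probability T R) (L : nat) (theta : nat -> T -> 'I_L).
Hypothesis mtheta : forall k l, measurable (theta k @^-1` [set l]).
Notation L1 f := (P.-integrable [set: T] (EFin \o f)).
Notation adapted := (adapted theta).
Notation hist := (hist theta).

(** An adapted factor has finite range, hence is bounded by the sum of the absolute values of its
    possible values. *)
Lemma L1_adapted k (f X : T -> R) :
  adapted k f -> L1 X -> L1 (fun w => f w * X w).
Proof.
move=> fa Xi; have [c fc] := adapted_factor 0 fa.
have mf : measurable_fun [set: T] f by exact: adapted_measurable_fun fa.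
apply: (@L1_le _ _ _ _ _ (fun w => (\sum_h `|c h|) * `|X w|)).
- by apply: measurable_funM => //; exact: L1_measurable Xi.
- by apply: L1Z; exact: integrable_norm.
- move=> w; rewrite normrM ler_wpM2r// fc (bigD1 (hist k w))//=.
  by rewrite lerDl sumr_ge0.
Qed.

Lemma L1_of_adapted k (f : T -> R) : adapted k f -> L1 f.
Proof.
move=> fa; apply: (@L1_ext _ _ _ _ (fun w => f w * 1)).
  by move=> w; rewrite mulr1.
apply: (L1_adapted fa); exact: (finite_measure_integrable_cst P 1 measurableT).
Qed.

Lemma L2_adapted k (f X : T -> R) :
  adapted k f -> L2 P X -> L2 P (fun w => f w * X w).
Proof.
move=> fa [mX Xi]; split.
  by apply: measurable_funM => //; exact: adapted_measurable_fun fa.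
apply: (@L1_ext _ _ _ _ (fun w => f w ^+ 2 * X w ^+ 2)).
  by move=> w; rewrite exprMn.
exact: (L1_adapted (adapted_comp (fun x => x ^+ 2) fa) Xi).
Qed.

Lemma L2_of_adapted k (f : T -> R) : adapted k f -> L2 P f.
Proof.
move=> fa; split; first exact: adapted_measurable_fun fa.
exact: (L1_of_adapted (adapted_comp (fun x => x ^+ 2) fa)).
Qed.

(** Write [f] as [f * 1]; the constant 1 is square-integrable because [P] is finite. *)
Lemma L2_L1 (f : T -> R) : L2 P f -> L1 f.
Proof.
move=> fi; apply: (@L1_ext _ _ _ _ (fun w => f w * 1)).
  by move=> w; rewrite mulr1.
have a1 : adapted 0 (fun=> 1 : R) by [].
by have := L2_mul fi (L2_of_adapted a1).
Qed.

Lemma adapted_indic k (E : set T) : adapted k E -> adapted k (\1_E : T -> R).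
Proof. move=> Ea w w' ww'; rewrite !indicE.
by have -> : (w \in E) = (w' \in E) by apply/idP/idP; rewrite !inE (Ea _ _ ww'). Qed.

Definition atom k (h : {ffun 'I_k -> 'I_L}) : set T := hist k @^-1` [set h].

Lemma adapted_atom k (h : {ffun 'I_k -> 'I_L}) : adapted k (atom h).
Proof. by move=> w w' ww'; rewrite /atom /= ww'. Qed.

Lemma Rintegral_hist k (c : {ffun 'I_k -> 'I_L} -> R) (X : T -> R) : L1 X ->
  \int[P]_w (c (hist k w) * X w) =
  \sum_h c h * \int[P]_w (\1_(atom h) w * X w).
Proof.
move=> Xi.
have ai h : L1 (fun w => \1_(atom h) w * X w).
  exact: L1_adapted (adapted_indic (adapted_atom h)) Xi.
transitivity (\int[P]_w (\sum_h c h * (\1_(atom h) w * X w))).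
  apply: eq_Rintegral => w _; rewrite (bigD1 (hist k w))//= big1 => [|h hw].
    by rewrite addr0 indicE mem_set// mul1r.
  rewrite indicE memNset ?mul0r ?mulr0// /atom /= => /esym/eqP.
  by rewrite (negPf hw).
rewrite Rintegral_sum; last by move=> h _; exact: L1Z.
by apply: eq_bigr => h _; rewrite RintegralZl.
Qed.

(** An adapted [f] is a finite linear combination of indicators of atoms, so testing on adapted
    events suffices. *)
Lemma Rintegral_adapted k (f X Y : T -> R) : adapted k f -> L1 X -> L1 Y ->
  (forall E, adapted k E -> \int[P]_w (\1_E w * X w) = \int[P]_w (\1_E w * Y w)) ->
  \int[P]_w (f w * X w) = \int[P]_w (f w * Y w).
Proof.
move=> fa Xi Yi XY; have [c fc] := adapted_factor 0 fa.
under eq_Rintegral do rewrite fc; under [RHS]eq_Rintegral do rewrite fc.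
rewrite !Rintegral_hist//; apply: eq_bigr => h _; congr (_ * _).
exact/XY/adapted_atom.
Qed.

(** Bridge between the extended-real integrals over events in [is_condexp] and the real integrals
    used for computation. *)
Lemma integral_indicM k (E : set T) (X : T -> R) : adapted k E -> L1 X ->
  (\int[P]_(w in E) (X w)%:E = (\int[P]_w (\1_E w * X w))%:E)%E.
Proof.
move=> Ea Xi; rewrite /Rintegral fineK.
  rewrite [LHS]integral_mkcond; apply: eq_integral => w _.
  by rewrite patchE indicE; case: ifP; rewrite ?mul1r ?mul0r.
apply: integrable_fin_num => //; exact: L1_adapted (adapted_indic Ea) Xi.
Qed.

(* On atoms of probability 0, the junk value x / 0 = 0 is harmless. *)
Definition cexp k (X : T -> R) (w : T) : R :=
  \int[P]_w' (\1_(atom (hist k w)) w' * X w') / fine (P (atom (hist k w))).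

Lemma adapted_cexp k X : adapted k (cexp k X).
Proof. by move=> w w' ww'; rewrite /cexp ww'. Qed.

(** Both sides are sums over atoms. On each atom [cexp] is constant, and integrating this constant
    multiplies it by the probability that it was divided by. *)
Lemma cexpP k (E : set T) (X : T -> R) : adapted k E -> L1 X ->
  \int[P]_w (\1_E w * cexp k X w) = \int[P]_w (\1_E w * X w).
Proof.
move=> Ea Xi; have [c fc] := adapted_factor 0 (adapted_indic Ea).
have i1 : L1 (fun=> 1).
  exact: (finite_measure_integrable_cst P 1 measurableT).
pose A (h : {ffun 'I_k -> 'I_L}) := \int[P]_w' (\1_(atom h) w' * X w').
(* The trailing factor 1 serves as the integrand [X] of [Rintegral_hist]. *)
transitivity (\int[P]_w
    (c (hist k w) * (A (hist k w) / fine (P (atom (hist k w)))) * 1)).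
  by apply: eq_Rintegral => w _; rewrite fc mulr1.
rewrite (Rintegral_hist (fun h => c h * (A h / fine (P (atom h))))) //.
under [RHS]eq_Rintegral do rewrite fc.
rewrite Rintegral_hist//; apply: eq_bigr => h _; rewrite -mulrA; congr (_ * _).
have mA : measurable (atom h).
  by apply: adapted_measurable_set (adapted_atom h).
have -> : \int[P]_w (\1_(atom h) w * 1) = fine (P (atom h)).
  rewrite -[LHS]/(fine _%:E) -(@integral_indicM k)//; last exact: adapted_atom.
  by rewrite integral_cst// mul1e.
(* For a null atom the left side carries a factor 0, and the right side is an integral over a null
   set. *)
have [P0|P0] := eqVneq (P (atom h)) 0%E; last first.
  by rewrite divfK// fine_eq0// fin_num_measure.
rewrite P0 /= mulr0 /A -[RHS]/(fine _%:E) -(@integral_indicM k)//; last first.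
  exact: adapted_atom.
rewrite null_set_integral//.
exact: measurable_funTS (measurable_int P Xi).
Qed.

End AdaptedIntegral.

(** * Inner products and the expansion of quadratic forms *)

Section DotProduct.
Context (R : realType).

Definition dotp p (a b : 'cV[R]_p) : R := (a^T *m b) ord0 ord0.

Lemma dotpE p (a b : 'cV[R]_p) : dotp a b = \sum_i a i ord0 * b i ord0.
Proof. by rewrite /dotp mxE; apply: eq_bigr => i _; rewrite mxE. Qed.

Lemma dotpDl p (a b c : 'cV[R]_p) : dotp (a + b) c = dotp a c + dotp b c.
Proof. by rewrite /dotp linearD /= mulmxDl mxE. Qed.

Lemma dotpDr p (a b c : 'cV[R]_p) : dotp a (b + c) = dotp a b + dotp a c.
Proof. by rewrite /dotp mulmxDr mxE. Qed.

Lemma dotp0r p (a : 'cV[R]_p) : dotp a 0 = 0.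
Proof. by rewrite /dotp mulmx0 mxE. Qed.

Lemma dotp_delta p (a : 'cV[R]_p) (e : R) i :
  dotp a (e *: delta_mx i ord0) = e * a i ord0.
Proof.
rewrite dotpE (bigD1 i)//= big1 => [|j ji]; rewrite !mxE.
  by rewrite !eqxx mulr1 addr0 mulrC.
by rewrite (negPf ji) !mulr0.
Qed.

Lemma dotp_mulmxl p q (M : 'M[R]_(p, q)) (a : 'cV[R]_p) (b : 'cV[R]_q) :
  dotp (M^T *m a) b = dotp a (M *m b).
Proof. by rewrite /dotp trmx_mul trmxK mulmxA. Qed.

Lemma qformE p (M : 'M[R]_p) (v : 'cV[R]_p) : qform M v = dotp v (M *m v).
Proof. by rewrite /qform /dotp mulmxA. Qed.

(** Symmetry of [M] makes the two cross terms equal, whence the factor 2. *)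
Lemma qform_expand p (M : 'M[R]_p) (a b : 'cV[R]_p) (e : R) :
  M \is symmetricmx ->
  qform M (a + e *: b) =
  qform M a + e * (2 * dotp (M *m a) b) + e ^+ 2 * qform M b.
Proof.
(* Symmetric means Hermitian for the identity conjugation and the sign $(-1)^0$; both are simplified
   away. *)
move=> /is_hermitianmxP; rewrite expr0 scale1r map_mx_id => // Msym.
have MT : M^T = M by rewrite {2}Msym.
rewrite /qform; have sym : (b^T *m M *m a) ord0 ord0 = dotp (M *m a) b.
  by rewrite /dotp trmx_mul MT -[in LHS](trmxK (_ *m a)) mxE !trmx_mul MT trmxK mulmxA.
have sym' : (a^T *m M *m b) ord0 ord0 = dotp (M *m a) b.
  by rewrite /dotp trmx_mul MT.
have -> : (a + e *: b)^T = a^T + e *: b^T by rewrite linearD linearZ.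
rewrite !mulmxDl !mulmxDr -!scalemxAl -!scalemxAr.
by move: sym sym'; rewrite !mxE => -> ->; ring.
Qed.

End DotProduct.

(** * Integrability and conditional expectation of random vectors *)

Section VectorAdapted.
Context (disp : measure_display) (T : measurableType disp) (R : realType).
Variables (P : probability T R) (L : nat) (theta : nat -> T -> 'I_L).
Hypothesis mtheta : forall k l, measurable (theta k @^-1` [set l]).
Notation L1 f := (P.-integrable [set: T] (EFin \o f)).
Notation adapted := (adapted theta).

Definition vL1 p (V : T -> 'cV[R]_p) : Prop :=
  forall i, L1 (fun w => V w i ord0).

Definition vL2 p (V : T -> 'cV[R]_p) : Prop :=
  forall i, L2 P (fun w => V w i ord0).

Lemma vL1D p (V W : T -> 'cV[R]_p) :
  vL1 V -> vL1 W -> vL1 (fun w => V w + W w).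
Proof. by move=> Vi Wi i; apply: L1_ext (L1D (Vi i) (Wi i)) => w; rewrite mxE. Qed.

Lemma vL2D p (V W : T -> 'cV[R]_p) :
  vL2 V -> vL2 W -> vL2 (fun w => V w + W w).
Proof. by move=> Vi Wi i; apply: L2_ext (L2D (Vi i) (Wi i)) => w; rewrite mxE. Qed.

Lemma vL2_vL1 p (V : T -> 'cV[R]_p) : vL2 V -> vL1 V.
Proof. by move=> Vi i; exact: (L2_L1 mtheta). Qed.

Lemma vL2_of_adapted k p (V : T -> 'cV[R]_p) : adapted k V -> vL2 V.
Proof.
by move=> Va i; exact: (L2_of_adapted P mtheta (adapted_comp (fun v : 'cV[R]_p => v i ord0) Va)).
Qed.

Lemma vL1_mulmx k p q (M : T -> 'M[R]_(p, q)) (V : T -> 'cV[R]_q) :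
  adapted k M -> vL1 V -> vL1 (fun w => M w *m V w).
Proof.
move=> Ma Vi i; apply: (@L1_ext _ _ _ _ (fun w => \sum_j M w i j * V w j ord0)).
  by move=> w; rewrite mxE.
apply: L1_sum => j _.
exact: (L1_adapted mtheta (adapted_comp (fun m : 'M[R]_(p, q) => m i j) Ma)).
Qed.

Lemma vL2_mulmx k p q (M : T -> 'M[R]_(p, q)) (V : T -> 'cV[R]_q) :
  adapted k M -> vL2 V -> vL2 (fun w => M w *m V w).
Proof.
move=> Ma Vi i; apply: (@L2_ext _ _ _ _ (fun w => \sum_j M w i j * V w j ord0)).
  by move=> w; rewrite mxE.
apply: L2_sum => j.
exact: (L2_adapted mtheta (adapted_comp (fun m : 'M[R]_(p, q) => m i j) Ma)).
Qed.

Lemma L1_dotp p (V W : T -> 'cV[R]_p) :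
  vL2 V -> vL2 W -> L1 (fun w => dotp (V w) (W w)).
Proof.
move=> Vi Wi; apply: (@L1_ext _ _ _ _ (fun w => \sum_i V w i ord0 * W w i ord0)).
  by move=> w; rewrite dotpE.
by apply: L1_sum => i _; exact: L2_mul.
Qed.

Lemma L1_dotp_adapted k p (V W : T -> 'cV[R]_p) :
  vL1 V -> adapted k W -> L1 (fun w => dotp (V w) (W w)).
Proof.
move=> Vi Wa; apply: (@L1_ext _ _ _ _ (fun w => \sum_i W w i ord0 * V w i ord0)).
  by move=> w; rewrite dotpE; apply: eq_bigr => i _; rewrite mulrC.
apply: L1_sum => i _.
exact: (L1_adapted mtheta (adapted_comp (fun v : 'cV[R]_p => v i ord0) Wa)).
Qed.

Lemma is_condexp_vL1 p G (X Y : T -> 'cV[R]_p) :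
  is_condexp P G X Y -> vL1 X /\ vL1 Y.
Proof. by case. Qed.

(** Taking out what is known, coordinate by coordinate. This is how the costate equations get paired
    with the adapted response of the state. *)
Lemma is_condexp_dotp k p (X Y Z : T -> 'cV[R]_p) :
  is_condexp P (chain_past theta (k%:Z - 1)) X Y -> adapted k Z ->
  \int[P]_w dotp (X w) (Z w) = \int[P]_w dotp (Y w) (Z w).
Proof.
move=> [Xi _ Yi XY] Za.
have Zai i : adapted k (fun w => Z w i ord0).
  exact: (adapted_comp (fun v : 'cV[R]_p => v i ord0) Za).
have dE (V : T -> 'cV[R]_p) : (forall i, L1 (fun w => V w i ord0)) ->
    \int[P]_w dotp (V w) (Z w) = \sum_i \int[P]_w (Z w i ord0 * V w i ord0).
  move=> Vi; rewrite -Rintegral_sum; last first.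
    by move=> i _; exact: (L1_adapted mtheta (Zai i)).
  apply: eq_Rintegral => w _; rewrite dotpE.
  by apply: eq_bigr => i _; rewrite mulrC.
rewrite !dE//; apply: eq_bigr => i _.
apply: (Rintegral_adapted mtheta (Zai i) (Xi i) (Yi i)) => E Ea.
apply: EFin_inj.
rewrite -(integral_indicM mtheta Ea (Xi i)) -(integral_indicM mtheta Ea (Yi i)).
by apply/esym/XY; exact/sigma_chain_pastP.
Qed.

Lemma is_condexpI k p (X Y : T -> 'cV[R]_p) : vL1 X -> adapted k Y ->
  (forall E i, adapted k E ->
     \int[P]_w (\1_E w * Y w i ord0) = \int[P]_w (\1_E w * X w i ord0)) ->
  is_condexp P (chain_past theta (k%:Z - 1)) X Y.
Proof.
move=> Xi Ya XY; have Yi := vL2_vL1 (vL2_of_adapted Ya).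
split=> //; first exact/measurable_wrtP.
move=> E /sigma_chain_pastP Ea i.
rewrite (integral_indicM mtheta Ea (Xi i)) (integral_indicM mtheta Ea (Yi i)).
by rewrite XY.
Qed.

Definition vcexp k p (X : T -> 'cV[R]_p) (w : T) : 'cV[R]_p :=
  \col_i cexp P theta k (fun w' => X w' i ord0) w.

Lemma vcexpP k p (X : T -> 'cV[R]_p) : vL1 X ->
  is_condexp P (chain_past theta (k%:Z - 1)) X (vcexp k X).
Proof.
move=> Xi; apply: is_condexpI => //.
  move=> w w' ww'; apply/matrixP => i j; rewrite !mxE.
  exact: (@adapted_cexp _ _ _ P _ theta).
move=> E i Ea; rewrite -(cexpP mtheta Ea (Xi i)).
by apply: eq_Rintegral => w _; rewrite mxE.
Qed.

End VectorAdapted.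

(** If D were nonzero, the choice $e = -tD$ with $t = 1/(|C|+1)$ would make the value $-D^2 t(1 -
    tC)$, which is negative because $tC < 1$. The sign of C is left free: the terminal penalties are
    only symmetric. *)
Lemma quadratic_ge0_linear_eq0 (R : realType) (D C : R) :
  (forall e, 0 <= e * D + e ^+ 2 * C) -> D = 0.
Proof.
move=> H; apply/eqP; apply: contraT => D0.
have t0 : 0 < (`|C| + 1)^-1 by rewrite invr_gt0 ltr_wpDl.
set t := (`|C| + 1)^-1 in t0.
have tC : t * C < 1.
  apply: (@le_lt_trans _ _ (t * `|C|)); first by rewrite ler_wpM2l ?ler_norm// ltW.
  by rewrite mulrC ltr_pdivrMr ?ltr_wpDl// mul1r ltrDl.
have DD : 0 < D ^+ 2 by rewrite exprn_even_gt0.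
have := H (- (t * D)).
have -> : - (t * D) * D + (- (t * D)) ^+ 2 * C = - (D ^+ 2 * (t * (1 - t * C))) by ring.
by rewrite oppr_ge0 leNgt mulr_gt0// mulr_gt0// subr_gt0.
Qed.

(** * Linearity of the state in the input and expansion of the cost along each sample path *)

Section StateResponse.
Context (R : realType) (disp : measure_display) (T : measurableType disp).
Variables (P : probability T R) (L n m d : nat) (theta : nat -> T -> 'I_L).
Hypothesis mtheta : forall k l, measurable (theta k @^-1` [set l]).
Variables (A : 'I_L -> nat -> 'M[R]_n) (B : 'I_L -> nat -> 'M[R]_(n, m)).
Notation state := (state d theta A B).
Notation L1 f := (P.-integrable [set: T] (EFin \o f)).
Notation adapted := (adapted theta).

Lemma adapted_mode X (M : 'I_L -> nat -> X) k :
  adapted k.+1 (fun w => M (theta k w) k).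
Proof. exact: (adapted_comp (fun l => M l k) (adapted_theta (ltnSn k))). Qed.
Arguments adapted_mode {X} M k.

Lemma state_vL2 x0 (u : int -> T -> 'cV[R]_m) k : vL2 P x0 ->
  (forall j, (j < k)%N -> vL2 P (u (j%:Z - d%:Z))) -> vL2 P (state x0 u k).
Proof.
move=> x0i; elim: k => [//|k IH] ui /=.
apply: vL2D.
  apply: (vL2_mulmx mtheta (adapted_mode A k)); apply: IH => j jk.
  by apply: ui; exact: ltnW.
by apply: (vL2_mulmx mtheta (adapted_mode B k)); exact: ui.
Qed.

(** The state at time k involves the modes up to k-1 only. This serves for the response to a
    perturbation, started at 0; the controlled trajectory may start from a random [x0]. *)
Lemma state_adapted x0 (u : int -> T -> 'cV[R]_m) k : adapted 0 x0 ->
  (forall j, (j < k)%N -> adapted j.+1 (u (j%:Z - d%:Z))) ->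
  adapted k (state x0 u k).
Proof.
move=> x0a; elim: k => [//|k IH] ua /=.
apply: (adapted_comp2 +%R); apply: (adapted_comp2 mulmx); try exact: adapted_mode.
  by apply: (adapted_le (leqnSn k)); apply: IH => j jk; apply: ua; exact: ltnW.
exact: ua.
Qed.

Lemma state_perturb x0 (u v : int -> T -> 'cV[R]_m) (e : R) k w :
  state x0 (fun z w => u z w + e *: v z w) k w =
  state x0 u k w + e *: state (fun=> 0) v k w.
Proof.
elim: k => [|k IH] /=; first by rewrite scaler0 addr0.
by rewrite IH !mulmxDr scalerDr -!scalemxAr addrACA.
Qed.

Variables (N : nat) (Q : 'I_L -> nat -> 'M[R]_n) (Rw : 'I_L -> nat -> 'M[R]_m).
Variable PN : 'I_L -> 'M[R]_n.

Definition pathwise_cost x0 (u : int -> T -> 'cV[R]_m) w : R :=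
  \sum_(0 <= k < N.+1) qform (Q (theta k w) k) (state x0 u k w) +
  \sum_(d <= k < N.+1) qform (Rw (theta k w) k) (u (k%:Z - d%:Z) w) +
  qform (PN (theta N.+1 w)) (state x0 u N.+1 w).

(** Half the derivative of [pathwise_cost] at [u] in the direction [v]; the state starting from 0 is
    the response to [v]. *)
Definition pathwise_variation x0 (u v : int -> T -> 'cV[R]_m) w : R :=
  \sum_(0 <= k < N.+1)
     dotp (Q (theta k w) k *m state x0 u k w) (state (fun=> 0) v k w) +
  \sum_(d <= k < N.+1)
     dotp (Rw (theta k w) k *m u (k%:Z - d%:Z) w) (v (k%:Z - d%:Z) w) +
  dotp (PN (theta N.+1 w) *m state x0 u N.+1 w) (state (fun=> 0) v N.+1 w).

(** By [state_perturb] each quadratic form is evaluated at a point shifted by [e] times a response,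
    so [qform_expand] applies term by term. *)
Lemma pathwise_cost_perturb x0 (u v : int -> T -> 'cV[R]_m) (e : R) w :
  (forall l k, (k <= N)%N -> Q l k \is symmetricmx) ->
  (forall l k, (d <= k <= N)%N -> Rw l k \is symmetricmx) ->
  (forall l, PN l \is symmetricmx) ->
  pathwise_cost x0 (fun z w => u z w + e *: v z w) w =
  pathwise_cost x0 u w +
  (e * (2 * pathwise_variation x0 u v w) +
   e ^+ 2 * pathwise_cost (fun=> 0) v w).
Proof.
move=> Qs Rs Ps; rewrite /pathwise_cost /pathwise_variation.
rewrite state_perturb qform_expand//.
under eq_big_nat => k kN do rewrite state_perturb qform_expand ?Qs//.
under [X in _ + X + _ = _]eq_big_nat => k kN do rewrite qform_expand ?Rs//.
by rewrite !big_split /= -!mulr_sumr; ring.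
Qed.

Lemma L1_qform k (M : 'I_L -> nat -> 'M[R]_n) (V : T -> 'cV[R]_n) :
  vL2 P V -> L1 (fun w => qform (M (theta k w) k) (V w)).
Proof.
move=> Vi; apply: L1_ext (L1_dotp Vi (vL2_mulmx mtheta (adapted_mode M k) Vi)) => w.
by rewrite qformE.
Qed.

End StateResponse.
Arguments adapted_mode {disp T L} theta {X} M k.

(** * Existence of the costate and its duality with the state response *)

Section Stationarity.
Context (R : realType) (disp : measure_display) (T : measurableType disp).
Variables (P : probability T R) (L n m d N : nat) (theta : nat -> T -> 'I_L).
Hypothesis mtheta : forall k l, measurable (theta k @^-1` [set l]).
Variables (A : 'I_L -> nat -> 'M[R]_n) (B : 'I_L -> nat -> 'M[R]_(n, m)).
Variables (Q : 'I_L -> nat -> 'M[R]_n) (Rw : 'I_L -> nat -> 'M[R]_m).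
Variable PN : 'I_L -> 'M[R]_n.
Variables (x0 : T -> 'cV[R]_n) (u : int -> T -> 'cV[R]_m).
Hypothesis x0_vL2 : vL2 P x0.
Hypothesis u_vL2 : forall k, (k <= N)%N -> vL2 P (u (k%:Z - d%:Z)).
Notation x := (state d theta A B x0 u).
Notation L1 f := (P.-integrable [set: T] (EFin \o f)).
Notation adapted := (adapted theta).

Lemma trajectory_vL2 k : (k <= N.+1)%N -> vL2 P (x k).
Proof.
move=> kN; apply: (state_vL2 mtheta) => // j jk; apply: u_vL2.
by rewrite -ltnS (leq_trans jk).
Qed.

(** Stated for any square-integrable data, so as to cover the optimal input, its perturbations, and
    the perturbation alone started from 0. *)
Lemma L1_pathwise_cost :
  L1 (pathwise_cost d theta A B N Q Rw PN x0 u).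
Proof.
apply: L1D; first apply: L1D.
- apply: L1_sum => j; rewrite mem_index_iota => /andP[_ jN].
  by apply: (L1_qform mtheta); apply: trajectory_vL2; exact: leqW.
- apply: L1_sum => j; rewrite mem_index_iota => /andP[_ jN].
  by apply: (L1_qform mtheta); exact: u_vL2.
- exact: (L1_qform mtheta N.+1 (fun l _ => PN l) (trajectory_vL2 (leqnn _))).
Qed.

Lemma costate_exists : exists lam, costate P N theta A Q PN x lam.
Proof.
(* Backward recursion in the time to go: [rec j] is the costate at time N-j, down to [rec N.+1] at
   time -1. The index [N - j] of [vcexp] stands for conditioning on $\mathcal{G}_{N-j-1}$. *)
pose rec := fix rec j := match j with
  | 0%N => vcexp P theta N.+1 (fun w => PN (theta N.+1 w) *m x N.+1 w)
  | j.+1 => vcexp P theta (N - j) (fun w =>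
      (A (theta (N - j)%N w) (N - j))^T *m rec j w +
       Q (theta (N - j)%N w) (N - j) *m x (N - j)%N w)
  end.
have t1 : vL1 P (fun w => PN (theta N.+1 w) *m x N.+1 w).
  apply: (vL2_vL1 mtheta).
  exact: (vL2_mulmx mtheta (adapted_mode theta (fun l _ => PN l) N.+1) (trajectory_vL2 _)).
have gen_i j V : (j <= N)%N -> vL1 P V ->
    vL1 P (fun w => (A (theta j w) j)^T *m V w + Q (theta j w) j *m x j w).
  move=> jN Vi; apply: vL1D.
    exact: (vL1_mulmx mtheta (adapted_mode theta (fun l k => (A l k)^T) j) Vi).
  apply: (vL2_vL1 mtheta); apply: (vL2_mulmx mtheta (adapted_mode theta Q j)).
  by apply: trajectory_vL2; exact: leqW.
have reci j : vL1 P (rec j).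
  elim: j => [|j IH]; first by have [] := is_condexp_vL1 (vcexpP mtheta N.+1 t1).
  exact: (is_condexp_vL1 (vcexpP mtheta (N - j) (gen_i _ _ (leq_subr _ _) IH))).2.
(* For z between -1 and N, the difference N-z is already nonnegative and [absz] only changes its
   type. *)
exists (fun z => rec (absz (N%:Z - z)%R)); split.
  rewrite subrr absz0.
  have -> : N%:Z = N.+1%:Z - 1 by lia.
  exact: vcexpP.
move=> k kN.
have -> : absz (N%:Z - (k%:Z - 1))%R = (N - k).+1 by lia.
have -> : absz (N%:Z - k%:Z)%R = (N - k)%N by lia.
rewrite /= subKn//.
by apply: (vcexpP mtheta); exact: gen_i.
Qed.

(** Summation by parts with $S_k = \mathrm{E}[\lambda_{k-1}'y(k)]$, where y is the response to [v]:
    the increments of S trade the Q terms for B terms, and its final value is the terminal term. *)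
Lemma costate_duality (v : int -> T -> 'cV[R]_m) lam :
  (forall k, (k <= N)%N -> adapted k.+1 (v (k%:Z - d%:Z))) ->
  costate P N theta A Q PN x lam ->
  \int[P]_w pathwise_variation d theta A B N Q Rw PN x0 u v w =
  \sum_(0 <= k < N.+1)
    \int[P]_w dotp ((B (theta k w) k)^T *m lam k%:Z w) (v (k%:Z - d%:Z) w) +
  \sum_(d <= k < N.+1)
    \int[P]_w dotp (Rw (theta k w) k *m u (k%:Z - d%:Z) w) (v (k%:Z - d%:Z) w).
Proof.
move=> va [lamN lamS].
pose y := state d theta A B (fun=> 0) v.
have ya k : (k <= N.+1)%N -> adapted k (y k).
  move=> kN; apply: state_adapted => // j jk; apply: va.
  by rewrite -ltnS (leq_trans jk).
have lami k : (k <= N)%N -> vL1 P (lam k%:Z).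
  rewrite leq_eqVlt => /predU1P[->|kN]; first by have [] := is_condexp_vL1 lamN.
  have [_] := is_condexp_vL1 (lamS k.+1 kN).
  by rewrite (_ : k.+1%:Z - 1 = k%:Z)//; lia.
have Qx k : (k <= N)%N -> L1 (fun w => dotp (Q (theta k w) k *m x k w) (y k w)).
  move=> kN; apply: (L1_dotp_adapted mtheta _ (ya _ (leqW kN))).
  apply: (vL2_vL1 mtheta); apply: (vL2_mulmx mtheta (adapted_mode theta Q k)).
  exact: trajectory_vL2 (leqW kN).
have Px : L1 (fun w => dotp (PN (theta N.+1 w) *m x N.+1 w) (y N.+1 w)).
  apply: (L1_dotp_adapted mtheta _ (ya _ (leqnn _))); apply: (vL2_vL1 mtheta).
  exact: (vL2_mulmx mtheta (adapted_mode theta (fun l _ => PN l) N.+1) (trajectory_vL2 _)).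
have Ru k : (d <= k <= N)%N -> L1 (fun w =>
    dotp (Rw (theta k w) k *m u (k%:Z - d%:Z) w) (v (k%:Z - d%:Z) w)).
  move=> /andP[_ kN]; apply: (L1_dotp_adapted mtheta _ (va _ kN)).
  apply: (vL2_vL1 mtheta); apply: (vL2_mulmx mtheta (adapted_mode theta Rw k)).
  exact: u_vL2.
pose S k := \int[P]_w dotp (lam (k%:Z - 1) w) (y k w).
have SS k : (k <= N)%N ->
    S k.+1 - S k =
    \int[P]_w dotp ((B (theta k w) k)^T *m lam k%:Z w) (v (k%:Z - d%:Z) w) -
    \int[P]_w dotp (Q (theta k w) k *m x k w) (y k w).
  move=> kN.
  have Al : vL1 P (fun w => (A (theta k w) k)^T *m lam k w).
    exact: (vL1_mulmx mtheta (adapted_mode theta (fun l k => (A l k)^T) k) (lami _ kN)).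
  have Bl : vL1 P (fun w => (B (theta k w) k)^T *m lam k w).
    exact: (vL1_mulmx mtheta (adapted_mode theta (fun l k => (B l k)^T) k) (lami _ kN)).
  have Aly := L1_dotp_adapted mtheta Al (ya _ (leqW kN)).
  have Blv := L1_dotp_adapted mtheta Bl (va _ kN).
  (* As y(k) is $\mathcal{G}_{k-1}$-measurable, $\lambda_{k-1}$ may be replaced by $A'\lambda_k +
     Qx(k)$. Its $A'\lambda_k$ part then cancels against the A part of y(k+1). *)
  rewrite /S -(is_condexp_dotp mtheta (lamS k kN) (ya _ (leqW kN))).
  rewrite (_ : k.+1%:Z - 1 = k%:Z); last by lia.
  under eq_Rintegral do rewrite /y /= dotpDr -!dotp_mulmxl.
  under [in X in _ - X]eq_Rintegral do rewrite dotpDl.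
  rewrite RintegralD// RintegralD//; last exact: Qx.
  by ring.
have SN : \int[P]_w dotp (PN (theta N.+1 w) *m x N.+1 w) (y N.+1 w) = S N.+1.
  move: lamN; rewrite [X in chain_past theta X](_ : N%:Z = N.+1%:Z - 1); last by lia.
  move=> /(is_condexp_dotp mtheta) /(_ (ya _ (leqnn _))) ->.
  by rewrite /S (_ : N.+1%:Z - 1 = N%:Z)//; lia.
(* The perturbation does not move the initial state, so y(0) = 0. *)
have S0 : S 0%N = 0.
  by rewrite /S /y /=; under eq_Rintegral do rewrite dotp0r; rewrite /Rintegral integral0.
rewrite /pathwise_variation RintegralD//; last first.
  apply: L1D; apply: L1_sum => k; rewrite mem_index_iota => kN; first exact: Qx.
  exact: Ru.
rewrite RintegralD//; last first.
- by apply: L1_sum => k; rewrite mem_index_iota => kN; exact: Ru.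
- by apply: L1_sum => k; rewrite mem_index_iota => kN; exact: Qx.
rewrite !Rintegral_sum; last first.
- by move=> k; rewrite mem_index_iota => kN; exact: Qx.
- by move=> k; rewrite mem_index_iota => kN; exact: Ru.
have STE : S N.+1 = \sum_(0 <= k < N.+1) (S k.+1 - S k).
  by rewrite telescope_sumr// S0 subr0.
rewrite SN STE.
under [X in _ + _ + X]eq_big_nat => k kN do rewrite SS//.
by rewrite sumrB /y; ring.
Qed.

End Stationarity.

(** * The maximum principle, by perturbing the optimal input *)

Theorem lemma1 (R : realType) (disp : measure_display)
    (T : measurableType disp) (P : probability T R)
    (L n m d N : nat) (d_gt0 : (0 < d)%N) (N_gtd : (d < N)%N)
    (Lam : 'M[R]_L) (theta : nat -> T -> 'I_L)
    (theta_markov : markov_chain P Lam theta)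
    (A : 'I_L -> nat -> 'M[R]_n) (B : 'I_L -> nat -> 'M[R]_(n, m))
    (Q : 'I_L -> nat -> 'M[R]_n) (Rw : 'I_L -> nat -> 'M[R]_m)
    (PN : 'I_L -> 'M[R]_n)
    (Q_psd : forall l k, (k <= N)%N -> psdmx (Q l k))
    (Rw_psd : forall l k, (d <= k <= N)%N -> psdmx (Rw l k))
    (PN_sym : forall l, PN l \is symmetricmx)
    (x0 : T -> 'cV[R]_n) (ui : int -> T -> 'cV[R]_m)
    (x0_L2 : forall i, (fun w => x0 w i ord0) \in Lfun P 2%:E)
    (ui_L2 : forall (k : int) i, - d%:Z <= k < 0 ->
       (fun w => ui k w i ord0) \in Lfun P 2%:E)
    (init_indep : indep_gen P (chain_events theta) (init_events d x0 ui))
    (u : int -> T -> 'cV[R]_m)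
    (u_opt : optimal P d N theta A B Q Rw PN x0 ui u) :
  let x := state d theta A B x0 u in
  (exists lam : int -> T -> 'cV[R]_n, costate P N theta A Q PN x lam) /\
  (forall lam : int -> T -> 'cV[R]_n, costate P N theta A Q PN x lam ->
     stationary P d N theta B Rw u lam).
Proof.
have mtheta : forall k l, measurable (theta k @^-1` [set l]) by case: theta_markov.
have [[u_init u_adapted] u_min] := u_opt.
have x0_vL2 : vL2 P x0 by move=> i; exact: Lfun_L2.
have u_vL2 k : (k <= N)%N -> vL2 P (u (k%:Z - d%:Z)).
  (* For k < d the input is prescribed and square-integrable by hypothesis; from k = d on it is
     adapted, hence of finite range. *)
  move=> kN; have [kd|dk] := ltnP k d.
    by rewrite u_init; [move=> i; apply/Lfun_L2/ui_L2; lia|lia].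
  have : measurable_wrt (chain_past theta (k%:Z - d%:Z)) (u (k%:Z - d%:Z)).
    by apply: u_adapted; lia.
  have -> : k%:Z - d%:Z = (k - d).+1%:Z - 1 by lia.
  by move=> /measurable_wrtP; exact: vL2_of_adapted.
split; first exact: costate_exists.
move=> lam lamP k /andP[dk kN].
have -> : chain_past theta (k%:Z - d%:Z) = chain_past theta ((k - d).+1%:Z - 1).
  by congr chain_past; lia.
have lami : vL1 P (lam k%:Z).
  move: kN; rewrite leq_eqVlt => /predU1P[->|kN].
    by have [] := is_condexp_vL1 lamP.1.
  have [_] := is_condexp_vL1 (lamP.2 k.+1 kN).
  by rewrite (_ : k.+1%:Z - 1 = k%:Z)//; lia.
have Bl : vL1 P (fun w => (B (theta k w) k)^T *m lam k%:Z w).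
  exact: (vL1_mulmx mtheta (adapted_mode theta (fun l k => (B l k)^T) k) lami).
have Ru : vL1 P (fun w => Rw (theta k w) k *m u (k%:Z - d%:Z) w).
  apply: (vL2_vL1 mtheta); apply: (vL2_mulmx mtheta (adapted_mode theta Rw k)).
  exact: u_vL2.
apply: (is_condexpI mtheta); [exact: vL1D|by []|move=> E i Ea].
(* Since d <= k, this direction vanishes at negative times and leaves the prescribed inputs
   unchanged. *)
pose v (z : int) (w : T) : 'cV[R]_m :=
  if z == k%:Z - d%:Z then \1_E w *: delta_mx i ord0 else 0.
have v_adapted j : adapted theta j.+1 (v (j%:Z - d%:Z)).
  rewrite /v; case: eqP => // jk; have -> : j = k by lia.
  apply: (adapted_comp (fun r : R => r *: delta_mx i ord0)).
  apply: adapted_indic; apply: adapted_le Ea; lia.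
have v_vL2 j : vL2 P (v (j%:Z - d%:Z)) by exact: vL2_of_adapted (v_adapted j).
have perturbation_admissible e :
    admissible d N theta ui (fun z w => u z w + e *: v z w).
  split=> z zP.
    rewrite -u_init//; apply/funext => w; rewrite /v ifF ?scaler0 ?addr0//.
    by apply/negbTE; lia.
  have uz := u_adapted z zP.
  (* Here z >= 0; the index is brought to the shifted form that [measurable_wrtP] expects. *)
  have zE : chain_past theta z = chain_past theta ((absz z).+1%:Z - 1).
    by congr chain_past; lia.
  rewrite zE in uz *; apply/measurable_wrtP; apply: (adapted_comp2 +%R).
    exact/measurable_wrtP.
  apply: (adapted_comp (fun a => e *: a)); rewrite /v; case: eqP => // zk.
  apply: (adapted_comp (fun r : R => r *: delta_mx i ord0)).
  apply: adapted_indic; apply: adapted_le Ea; lia.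
pose J := pathwise_cost d theta A B N Q Rw PN.
pose V := pathwise_variation d theta A B N Q Rw PN x0 u v.
have JE e w : J x0 (fun z w => u z w + e *: v z w) w =
    J x0 u w + (e * (2 * V w) + e ^+ 2 * J (fun=> 0) v w).
  apply: pathwise_cost_perturb => // l j jN; first by have [] := Q_psd l j jN.
  by have [] := Rw_psd l j jN.
have Ju_L1 : P.-integrable [set: T] (EFin \o J x0 u).
  exact: (L1_pathwise_cost mtheta).
have Jv_L1 : P.-integrable [set: T] (EFin \o J (fun=> 0) v).
  by apply: (L1_pathwise_cost mtheta) => // i'; apply: L2_ext (L2_0 P) => w; rewrite mxE.
have Juv_L1 e : P.-integrable [set: T]
    (EFin \o J x0 (fun z w => u z w + e *: v z w)).
  apply: (L1_pathwise_cost mtheta) => // j jN; apply: vL2D; first exact: u_vL2.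
  have := adapted_comp (fun a => e *: a) (v_adapted j).
  exact: vL2_of_adapted.
(* Setting e = 1 in [JE] gives $V = (J(u+v) - J(u) - J(v))/2$, with J(v) started from 0, so
   integrability comes from that of the three costs. *)
have V_L1 : P.-integrable [set: T] (EFin \o V).
  apply: L1_ext (L1Z 2^-1 (L1D (Juv_L1 1) (L1Z (-1) (L1D Ju_L1 Jv_L1)))) => w.
  by rewrite JE; field.
(* All expectations being finite, optimality against $u + ev$ becomes nonnegativity of a real
   quadratic in e without constant term. *)
have V0 : 2 * \int[P]_w V w = 0.
  apply: (quadratic_ge0_linear_eq0 (C := \int[P]_w J (fun=> 0) v w)) => e.
  have := u_min _ (perturbation_admissible e).
  rewrite /cost unlock -/(J x0 u) -/(J x0 (fun z w => u z w + e *: v z w)).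
  have fE f : P.-integrable [set: T] (EFin \o f) ->
      (\int[P]_w (f w)%:E)%E = (\int[P]_w f w)%R%:E.
    by move=> fi; rewrite /Rintegral fineK//; exact: integrable_fin_num.
  rewrite (fE _ Ju_L1) (fE _ (Juv_L1 e)) lee_fin.
  under [leRHS]eq_Rintegral do rewrite JE.
  have eV : P.-integrable [set: T] (EFin \o fun w => e * (2 * V w)).
    exact: L1Z (L1Z _ V_L1).
  have eJ := L1Z (e ^+ 2) Jv_L1.
  rewrite RintegralD//; last exact: L1D eV eJ.
  rewrite (RintegralD _ eV eJ)// !RintegralZl//; last exact: L1Z V_L1.
  by rewrite lerDl.
(* Both sums of the duality formula, from a = 0 and from a = d, retain only the term j = k. *)
have pick (F : nat -> T -> 'cV[R]_m) a : (a <= k)%N ->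
    \sum_(a <= j < N.+1) \int[P]_w dotp (F j w) (v (j%:Z - d%:Z) w) =
    \int[P]_w (\1_E w * F k w i ord0).
  move=> ak; rewrite (bigD1_seq k) ?iota_uniq ?mem_index_iota ?ak//=.
  rewrite big1 ?addr0 => [|j jk].
    by apply: eq_Rintegral => w _; rewrite /v eqxx dotp_delta.
  have -> : v (j%:Z - d%:Z) = fun=> 0.
    by apply/funext => w; rewrite /v ifF//; apply/negbTE; move/eqP in jk; lia.
  by under eq_Rintegral do rewrite dotp0r; rewrite /Rintegral integral0.
have := costate_duality mtheta Rw x0_vL2 u_vL2 (fun j _ => v_adapted j) lamP.
rewrite -/V.
rewrite (pick (fun j w => (B (theta j w) j)^T *m lam j%:Z w)) //.
rewrite (pick (fun j w => Rw (theta j w) j *m u (j%:Z - d%:Z) w)) //.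
move/eqP: V0; rewrite mulf_eq0 pnatr_eq0 /= => /eqP -> VE.
have i1 := L1_adapted mtheta (adapted_indic R Ea) (Bl i).
have i2 := L1_adapted mtheta (adapted_indic R Ea) (Ru i).
(* The candidate conditional expectation is 0, so the left side vanishes; the right side splits into
   the two terms that [VE] sums to 0. *)
under eq_Rintegral do rewrite mxE mulr0.
under [RHS]eq_Rintegral do rewrite mxE mulrDr.
by rewrite RintegralD// -VE /Rintegral integral0.
Qed.
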